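(* Let $\langle \mathrm{VAR},\mathrm{CON},\mathrm{FUN},\mathrm{REL},\mathrm{type}\rangle$ be a signature, $x\in\mathrm{VAR}$, $c\in\mathrm{CON}$ with $\mathrm{type}(x)=\mathrm{type}(c)$, and $P\in\mathrm{REL}$ with $\mathrm{type}(P)=\langle\mathsf{agtobj}\rangle$. Then the formula $x=c\to(P(x)\to P(c))$ is not provable in $\mathbf{H}\mathsf{K}$.
   Context: Types $\mathsf{TYPE}=\{\mathsf{agt},\mathsf{obj},\mathsf{agtobj}\}$ ordered by the reflexive order $\preccurlyeq$ with $\mathsf{agt}\preccurlyeq\mathsf{agtobj}$, $\mathsf{obj}\preccurlyeq\mathsf{agtobj}$. A signature $\langle \mathrm{VAR},\mathrm{CON},\mathrm{FUN},\mathrm{REL},\mathrm{type}\rangle$: countably infinite set $\mathrm{VAR}$ of variables, each typed $\mathsf{agt}$ or $\mathsf{obj}$ with infinitely many of each type; countable set $\mathrm{CON}$ of constants typed $\mathsf{agt}$ or $\mathsf{obj}$; countable set $\mathrm{FUN}$ of function symbols, each $f$ typed $\langle\tau_1,\dots,\tau_n,\tau_{n+1}\rangle$ with $\tau_i\in\mathsf{TYPE}$, $\tau_{n+1}\in\{\mathsf{agt},\mathsf{obj}\}$; countable set $\mathrm{REL}$ of relation symbols containing $=$ with $\mathrm{type}(=)=\langle\mathsf{agtobj},\mathsf{agtobj}\rangle$, other $P$ typed in $\mathsf{TYPE}^n$. Terms: variables and constants of their types; $f(t_1,\dots,t_n)$ is a term of type $\tau'_{n+1}$ when $\mathrm{type}(f)=\langle\tau'_1,\dots,\tau'_{n+1}\rangle$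 and $\mathrm{type}(t_i)\preccurlyeq\tau'_i$. Formulas: $P(t_1,\dots,t_n)$ with $\mathrm{type}(t_i)\preccurlyeq$ the $i$-th argument type of $P$ ($P$ may be $=$), $\neg\varphi$, $\varphi\wedge\psi$, $K_s\varphi$ with $\mathrm{type}(s)=\mathsf{agt}$, $\forall x\varphi$; $\varphi\to\psi:=\neg(\varphi\wedge\neg\psi)$, $\exists x\varphi:=\neg\forall x\neg\varphi$, $t\neq s:=\neg(t=s)$. Free variables of $K_t\varphi$: variables of $t$ and free variables of $\varphi$. Substitution $\varphi(s/x)$ is the usual one with $(K_t\varphi)(s/x)=K_{t(s/x)}\varphi(s/x)$, used only when $\mathrm{type}(x)=\mathrm{type}(s)$ and no variable of $s$ is bound in $\varphi$. The Hilbert-style system $\mathbf{H}\mathsf{K}$: axioms are all propositional tautologies; $\forall x\varphi\to\varphi(y/x)$ ($y$ a variable); $t=t$; $x=y\to(\varphi(x/z)\to\varphi(y/z))$ ($x,y$ variables); $c=c\to\exists x(x=c)$; $x\neq y$ whenever $\mathrm{type}(x)\neq\mathrm{type}(y)$; $K_t(\varphi\to\psi)\to(K_t\varphi\to K_t\psi)$; $\forall xK_t\varphi\to K_t\forall x\varphi$ for $x$ not occurring in $t$; $x\neq y\to K_t\,x\neq y$. Rules: from $\varphi$ and $\varphi\to\psi$ infer $\psi$; from $\varphi$ infer $K_t\varphi$; from $\varphi\to\psi$ infer $\varphi\to\forall x\psi$ for $x$ not free in $\varphi$. Provability is defined as usual. *)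

(* Defs.v *)
From HB Require Import structures.
From mathcomp Require Import all_boot.

Set Implicit Arguments.
Unset Strict Implicit.
Unset Printing Implicit Defensive.

Inductive ttype := agt | obj | agtobj.

Definition ttype_code (a : ttype) : option bool :=
  match a with agt => Some true | obj => Some false | agtobj => None end.

Definition ttype_decode (o : option bool) : ttype :=
  match o with Some true => agt | Some false => obj | None => agtobj end.

Lemma ttype_codeK : cancel ttype_code ttype_decode.
Proof. by case. Qed.

HB.instance Definition _ := Equality.copy ttype (can_type ttype_codeK).

Definition subtype (a b : ttype) : bool := (a == b) || (b == agtobj).

Definition basic (a : ttype) : bool := a \in [:: agt; obj].

(* Symbols of arity 0 are allowed in [fsym] and [rsym]. Nothing distinguishes
   [eqsym] from the other relation symbols except its name and its type. *)
Record signature := Signature {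
  var : countType;
  con : countType;
  fsym : countType;
  rsym : countType;
  eqsym : rsym;
  var_type : var -> ttype;
  con_type : con -> ttype;
  fun_args : fsym -> seq ttype;
  fun_res : fsym -> ttype;
  rel_type : rsym -> seq ttype;
  var_type_basic : forall x, basic (var_type x);
  (* no finite list exhausts the variables of a given basic type *)
  var_type_infinite : forall (a : ttype) (s : seq var), basic a ->
    exists2 x, x \notin s & var_type x = a;
  con_type_basic : forall c, basic (con_type c);
  fun_res_basic : forall f, basic (fun_res f);
  eqsym_type : rel_type eqsym = [:: agtobj; agtobj]
}.

Section Syntax.
Variable S : signature.

(* Raw expressions; the terms and formulas of the typed language are those
   satisfying [wf_term] and [wf]. *)
Inductive term :=
  | Var of var S
  | Con of con S
  | App of fsym S & seq term.

Inductive form :=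
  | Rel of rsym S & seq term
  | Not of form
  | And of form & form
  | Know of term & form
  | All of var S & form.

Definition Eq (s t : term) : form := Rel (eqsym S) [:: s; t].
Definition Neq (s t : term) : form := Not (Eq s t).
Definition Imp (p q : form) : form := Not (And p (Not q)).
Definition Ex (x : var S) (p : form) : form := Not (All x (Not p)).

Definition type_of (t : term) : ttype :=
  match t with
  | Var x => var_type x
  | Con c => con_type c
  | App f _ => fun_res f
  end.

(* [all2] is false on lists of different lengths, so this also fixes arity. *)
Definition args_ok (ts : seq term) (tys : seq ttype) : bool :=
  all2 subtype (map type_of ts) tys.

Fixpoint wf_term (t : term) : bool :=
  match t with
  | App f ts => all wf_term ts && args_ok ts (fun_args f)
  | _ => true
  end.

Fixpoint wf (p : form) : bool :=
  match p with
  | Rel P ts => all wf_term ts && args_ok ts (rel_type P)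
  | Not q => wf q
  | And q r => wf q && wf r
  | Know t q => [&& wf_term t, type_of t == agt & wf q]
  | All _ q => wf q
  end.

Fixpoint tvars (t : term) : seq (var S) :=
  match t with
  | Var x => [:: x]
  | Con _ => [::]
  | App _ ts => flatten (map tvars ts)
  end.

Fixpoint fv (p : form) : seq (var S) :=
  match p with
  | Rel _ ts => flatten (map tvars ts)
  | Not q => fv q
  | And q r => fv q ++ fv r
  | Know t q => tvars t ++ fv q
  | All x q => [seq y <- fv q | y != x]
  end.

Fixpoint bv (p : form) : seq (var S) :=
  match p with
  | Rel _ _ => [::]
  | Not q => bv q
  | And q r => bv q ++ bv r
  | Know _ q => bv q
  | All x q => x :: bv q
  end.

Fixpoint tsubst (s : term) (x : var S) (t : term) : term :=
  match t with
  | Var y => if y == x then s else Var y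
  | Con c => Con c
  | App f ts => App f (map (tsubst s x) ts)
  end.

(* [subst s x p] is p(s/x); it does not rename bound variables and is only
   used under [subst_ok s x p]. *)
Fixpoint subst (s : term) (x : var S) (p : form) : form :=
  match p with
  | Rel P ts => Rel P (map (tsubst s x) ts)
  | Not q => Not (subst s x q)
  | And q r => And (subst s x q) (subst s x r)
  | Know t q => Know (tsubst s x t) (subst s x q)
  | All y q => if y == x then All y q else All y (subst s x q)
  end.

Definition subst_ok (s : term) (x : var S) (p : form) : Prop :=
  var_type x = type_of s /\ {in tvars s, forall y, y \notin bv p}.

(* Formulas that are neither negations nor conjunctions act as propositional
   letters, with truth values given by [v]. *)
Fixpoint peval (v : form -> bool) (p : form) : bool :=
  match p with
  | Not q => ~~ peval v q
  | And q r => peval v q && peval v r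
  | _ => v p
  end.

Definition tautology (p : form) : Prop := forall v, peval v p.

Inductive HK_axiom : form -> Prop :=
  | ax_taut p : tautology p -> HK_axiom p
  | ax_all x y p : subst_ok (Var y) x p ->
      HK_axiom (Imp (All x p) (subst (Var y) x p))
  | ax_refl t : HK_axiom (Eq t t)
  | ax_leibniz x y z p : subst_ok (Var x) z p -> subst_ok (Var y) z p ->
      HK_axiom (Imp (Eq (Var x) (Var y))
                    (Imp (subst (Var x) z p) (subst (Var y) z p)))
  (* The scheme carries no condition relating the types of [x] and [c];
     restricting it to equal types would only yield a weaker system. *)
  | ax_exid c x :
      HK_axiom (Imp (Eq (Con c) (Con c)) (Ex x (Eq (Var x) (Con c))))
  | ax_disjoint x y : var_type x <> var_type y ->
      HK_axiom (Neq (Var x) (Var y))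
  | ax_K t p q :
      HK_axiom (Imp (Know t (Imp p q)) (Imp (Know t p) (Know t q)))
  | ax_barcan x t p : x \notin tvars t ->
      HK_axiom (Imp (All x (Know t p)) (Know t (All x p)))
  | ax_know_neq x y t :
      HK_axiom (Imp (Neq (Var x) (Var y)) (Know t (Neq (Var x) (Var y)))).

(* The schemes range over formulas of the typed language, whence the [wf] side
   condition; all theorems are then well-formed. *)
Inductive HK_provable : form -> Prop :=
  | HK_ax p : wf p -> HK_axiom p -> HK_provable p
  | HK_mp p q : HK_provable p -> HK_provable (Imp p q) -> HK_provable q
  | HK_nec t p : wf_term t -> type_of t = agt ->
      HK_provable p -> HK_provable (Know t p)
  | HK_gen x p q : x \notin fv p ->
      HK_provable (Imp p q) -> HK_provable (Imp p (All x q)).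

End Syntax.

(* Main.v *)
Require Import Defs.
From mathcomp Require Import all_boot.

(** Since variables are only ever instantiated by variables, a term other than
    a variable may denote something outside the range of the quantifiers. Take
    a single reflexive world in which the variables of type [a] range over the
    singleton [{a}], and let every other term denote one extra object that is
    equal to everything. Then [K_t] and [forall x] are vacuous, all axioms hold,
    and if [P] holds of everything but the extra object, [x = c] and [P(x)] are
    true while [P(c)] is false. *)

Section CollapsedModel.
Variable S : signature.

(* [None] is the extra object. *)
Definition denot (t : term S) : option ttype :=
  if t is Var x then Some (var_type x) else None.

Definition collapsed_eq (ds : seq (option ttype)) : bool :=
  if ds is [:: Some a; Some b] then a == b else true.

(** No assignment is carried along: the type of a variable already fixes its value. *)
Fixpoint holds (p : form S) : bool :=
  match p with
  | Rel R ts => if R == eqsym S then collapsed_eq (map denot ts)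
                else all isSome (map denot ts)
  | Not q => ~~ holds q
  | And q r => holds q && holds r
  | Know _ q => holds q
  | All _ q => holds q
  end.

Lemma holds_Imp p q : holds (Imp p q) = (holds p ==> holds q).
Proof. by rewrite /= negb_and negbK implybE. Qed.

Lemma holds_Eq s t : holds (Eq s t) = collapsed_eq [:: denot s; denot t].
Proof. by rewrite /= eqxx. Qed.

Lemma holds_tautology p : tautology p -> holds p.
Proof.
(* [holds] serves as its own valuation of the propositional letters. *)
move=> /(_ holds); suff -> : peval holds p = holds p by [].
by elim: p => //= [q -> | q -> r ->].
Qed.

(** Both variables denote their common type; a constant in place of [Var y] would break this. *)
Lemma denot_tsubst x y t :
  var_type x = var_type y -> denot (tsubst (Var y) x t) = denot t.
Proof. by move=> xy; case: t => //= z; case: eqP => //= ->; rewrite xy. Qed.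

Lemma holds_subst x y p :
  var_type x = var_type y -> holds (subst (Var y) x p) = holds p.
Proof.
move=> xy; elim: p => //= [R ts | q -> | q -> r -> | z q IHq] //.
  rewrite -map_comp; suff -> : map (denot \o tsubst (Var y) x) ts = map denot ts.
    by [].
  by apply: eq_map => t; apply: denot_tsubst.
by case: eqP.
Qed.

Lemma holds_axiom p : HK_axiom p -> holds p.
Proof.
case=> {p}.
- exact: holds_tautology.
- by move=> x y p [xy _]; rewrite holds_Imp /= holds_subst ?implybb.
- by move=> t; rewrite holds_Eq /=; case: (denot t) => /=.
- move=> x y z p [zx _] [zy _].
  by rewrite !holds_Imp !holds_subst // implybb implybT.
(* [Con c] denotes [None], so [x = c] holds whatever the type of [x]. *)
- by move=> c x; rewrite holds_Imp /= eqxx.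
- by move=> x y /eqP; rewrite /= eqxx.
- by move=> t p q; rewrite !holds_Imp /= -holds_Imp implybb.
- by move=> x t p _; rewrite holds_Imp implybb.
- by move=> x y t; rewrite holds_Imp implybb.
Qed.

Lemma holds_provable p : HK_provable p -> holds p.
Proof.
elim=> {p} // [p _ /holds_axiom // | p q _ hp _].
by rewrite holds_Imp hp.
Qed.

End CollapsedModel.

Theorem mainTheorem3 (S : signature) (x : var S) (c : con S) (P : rsym S)
    (type_xc : var_type x = con_type c) (type_P : rel_type P = [:: agtobj]) :
  ~ HK_provable (Imp (Eq (Var x) (Con c))
                     (Imp (Rel P [:: Var x]) (Rel P [:: Con c]))).
Proof.
(* The arities differ, so [P] is interpreted by [all isSome]. *)
have PnE : (P == eqsym S) = false.
  by apply/eqP => PE; move: type_P; rewrite PE eqsym_type.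
by move=> /holds_provable; rewrite !holds_Imp /= eqxx PnE.
Qed.
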